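(* Let $a\in(0,1)$, $b>a$ and $\alpha>1$. Then, for $\lambda$-almost every $y\in[0,1]$, the mass dimension of the set $\{n\in\mathbb{P}:\ \langle\alpha^{n^b}y\rangle<n^{-a}\}$ exists and $$\dim_{\mathrm M}\Big(\Big\{n\in\mathbb{P}:\ \langle\alpha^{n^b}y\rangle<n^{-a}\Big\}\Big)=1-a.$$
   Context: $\lambda$ is Lebesgue measure on $[0,1]$; $\mathbb{P}$ is the set of prime numbers; $\langle x\rangle$ denotes the distance from the real number $x$ to the nearest integer. For a non-empty $A\subseteq\mathbb{N}=\{1,2,\dots\}$, the mass dimension of $A$ is said to exist if the limit $\dim_{\mathrm M}(A)=\lim_{N\to\infty}\frac{\log|A\cap[1,N]|}{\log N}$ exists. *)

(* Defs.v *)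
From HB Require Import structures.
From mathcomp Require Import all_boot all_order all_algebra.
From mathcomp Require Import all_classical all_reals all_analysis.

Set Implicit Arguments.
Unset Strict Implicit.
Unset Printing Implicit Defensive.

Import Order.TTheory GRing.Theory Num.Theory.
Import numFieldNormedType.Exports.

Local Open Scope classical_set_scope.
Local Open Scope ring_scope.

Definition dist_int (R : realType) (x : R) : R :=
  inf [set `|x - m%:~R| | m in [set: int]].

(* The positive integers are modelled inside [nat]; 0 is never counted. *)
Definition count_upto (A : set nat) (N : nat) : nat :=
  (\sum_(1 <= n < N.+1 | n \in A) 1)%N.

(* The finitely many N with [count_upto A N = 0] or [N <= 1], where [ln] or the
   division takes a default value, do not affect the limit when A contains a
   positive integer. *)
Definition log_density (R : realType) (A : set nat) (N : nat) : R :=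
  ln (count_upto A N)%:R / ln N%:R.

Definition mass_dim_exists (R : realType) (A : set nat) : Prop :=
  A !=set0 /\ cvgn (log_density R A).

Definition mass_dim (R : realType) (A : set nat) : R :=
  limn (log_density R A).

Definition approx_primes (R : realType) (a b alpha y : R) : set nat :=
  [set n | prime n /\ dist_int (alpha `^ (n%:R `^ b) * y) < n%:R `^ (- a)].

(* Main.v *)
Require Import Defs.
From HB Require Import structures.
From mathcomp Require Import all_boot all_order all_algebra.
From mathcomp Require Import all_classical all_reals all_analysis.
From mathcomp Require Import measurable_realfun measurable_fun_approximation.
From mathcomp Require Import ring lra zify.
Import Order.TTheory GRing.Theory Num.Theory.
Import numFieldNormedType.Exports.
Local Open Scope classical_set_scope.
Local Open Scope ring_scope.

(** Write x_n = alpha^(n^b) and d_n = n^(-a). For y uniform in [0, 1], the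
    event that x_n y is within d_n of an integer has probability comparable to
    d_n, so up to N the expected number of primes n for which it occurs is
    comparable to the sum of d_p over the primes p <= N. This sum is at most
    N^(1-a) / (1-a), and at least a constant times N^(1-a) / log N because
    there are at least a constant times N / log N primes up to N
    ([chebyshev_pow2], from the prime factorisation of the central binomial
    coefficient). The dimension 1 - a is insensitive to powers of log N, so
    it suffices to show that, almost surely, the actual count agrees with its
    expectation up to such factors; since counts are monotone in N, it even
    suffices to do this along N = 2^k ([log_density_cvg]).

    Upper bound ([ae_count_upto_le]): no independence is used. The counts at
    2^k, divided by (k+1) (k+2) 2^(k(1-a)), have integrals with finite sum, so
    almost surely they form a bounded sequence
    ([ae_bounded_of_sum_integral]).

    Lower bound ([ae_count_upto_ge]): this is a second moment argument, and the
    place where b > a matters. For m < n the set of y where x_m y is close to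
    an integer consists of about x_m intervals, and each of them is long
    compared with the period 1 / x_n of the n-th condition when x_n is much
    larger than x_m / d_m. Hence the two events are independent up to errors
    of order d_n x_m / x_n and d_m d_n / x_m ([near_int_pair_le]). Take c with
    a < c < min(1, b).
    As n^b - m^b >= n^c - m^c >= c n^(c-1) (n - m), the ratios x_m / x_n with
    n fixed are dominated by a geometric series of sum O(n^(1-c))
    ([sum_ratio_le]); the sum of the 1 / x_m is O(N^(1-c)) as well
    ([sum_inv_le]). With M the sum of the d_p over the primes p <= N, the
    variance of the count is therefore O(M N^(1-c)) ([near_int_variance]), and
    divided by M^2 it is O(N^(a-c) log N), which is summable along N = 2^k,
    even after multiplication by k. So almost surely the count at 2^k
    eventually exceeds M / 2.

    For the lower bound only the one-sided condition, that the fractional part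
    of x_n y is less than d_n, is considered. It is more restrictive, its
    probability is d_n up to O(d_n / x_n) for every d_n <= 1
    ([near_int_measure_ge]), and its expected count has the same order of
    magnitude. *)

Set Implicit Arguments.
Unset Strict Implicit.

(** * A Chebyshev lower bound for the number of primes *)

Lemma expn2_le_bin k : (2 ^ k <= 'C(k.*2, k))%N.
Proof.
elim: k => [|k IH]; first by rewrite bin0.
rewrite doubleS binS.
have -> : 'C(k.*2.+1, k.+1) = 'C(k.*2.+1, k).
  rewrite -bin_sub; last by lia.
  by congr 'C(_, _); lia.
rewrite addnn -mul2n expnS leq_mul2l /=.
apply: (leq_trans IH).
case: k {IH} => [|k]; first by rewrite bin0.
by rewrite [X in (_ <= X)%N]binS leq_addr.
Qed.

(** By Legendre's formula the exponent of p in the binomial coefficient is the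
    sum over i of floor (2k / p^i) - 2 floor (k / p^i); each term is 0 or 1,
    and it vanishes once p^i > 2k. *)
Lemma logn_bin_le p k : prime p -> (0 < k)%N ->
  (p ^ logn p 'C(k.*2, k) <= k.*2)%N.
Proof.
move=> p_pr k0.
have p1 := prime_gt1 p_pr.
set N := k.*2.
have Hk : (k <= N)%N by rewrite /N; lia.
have E : (logn p 'C(N, k) + (logn p k`! + logn p k`!) = logn p N`!)%N.
  rewrite -(bin_fact Hk) (_ : (N - k = k)%N); last by rewrite /N; lia.
  by rewrite lognM ?muln_gt0 ?fact_gt0 ?bin_gt0 ?Hk// lognM ?fact_gt0.
have {E} E : (logn p 'C(N, k) + \sum_(1 <= i < N.+1) (k %/ p ^ i + k %/ p ^ i)
   = \sum_(1 <= i < N.+1) N %/ p ^ i)%N.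
  rewrite -logn_fact// -E big_split/=; congr (_ + _)%N.
  suff -> : (\sum_(1 <= i < N.+1) k %/ p ^ i = logn p k`!)%N by [].
  rewrite logn_fact// (big_cat_nat (n := k.+1))//=.
  rewrite [X in (_ + X)%N]big_nat [X in (_ + X)%N]big1 ?addn0// => i /andP[ki _].
  rewrite divn_small//; apply: (leq_trans ki).
  by apply: ltnW; apply: ltn_expl.
set t := trunc_log p N.
have N0 : (0 < N)%N by rewrite /N; lia.
have : (\sum_(1 <= i < N.+1) N %/ p ^ i <=
   \sum_(1 <= i < N.+1) ((i <= t) + (k %/ p ^ i + k %/ p ^ i)))%N.
  rewrite big_nat [X in (_ <= X)%N]big_nat; apply: leq_sum => i /andP[i1 iN].
  have pi0 : (0 < p ^ i)%N by rewrite expn_gt0; lia.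
  case: (leqP i t) => it /=.
    have := divn_eq k (p ^ i); have := ltn_pmod k pi0.
    set r := (k %% _)%N; set q := (k %/ _)%N => rp kE.
    have : (N %/ p ^ i < q + q + 2)%N; last by lia.
    by rewrite ltn_divLR// /N; lia.
  rewrite divn_small//; apply: (leq_trans (trunc_log_ltn N p1)).
  by rewrite leq_exp2l.
rewrite -E [X in (_ <= X)%N]big_split/= leq_add2r => H.
apply: (@leq_trans (p ^ t)); last by rewrite trunc_logP.
rewrite leq_exp2l//; apply: (leq_trans H).
have tN : (t <= N)%N.
  apply: (@leq_trans (p ^ t)); last by rewrite trunc_logP.
  by apply: ltnW; apply: ltn_expl.
rewrite (big_cat_nat (n := t.+1))//=.
rewrite [X in (_ + X <= _)%N]big_nat [X in (_ + X <= _)%N]big1 ?addn0.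
  apply: (@leq_trans (\sum_(1 <= i < t.+1) 1)%N).
    by apply: leq_sum => i _; case: (i <= t)%N.
  by rewrite sum_nat_const_nat; lia.
by move=> i /andP[ti _]; rewrite leqNgt ti.
Qed.

(** Every prime factor of the binomial coefficient is at most 2k, and each
    contributes a prime power that is at most 2k. *)
Lemma bin_le_exp_primes k : (0 < k)%N ->
  ('C(k.*2, k) <= k.*2 ^ (\sum_(1 <= p < k.*2.+1 | prime p) 1))%N.
Proof.
move=> k0; set N := k.*2.
have C0 : (0 < 'C(N, k))%N by rewrite bin_gt0 /N; lia.
have Hp : forall p, prime p -> (N < p)%N -> logn p 'C(N, k) = 0%N.
  move=> p p_pr Np; apply/eqP; rewrite eqn0Ngt; apply/negP => l0.
  have := logn_bin_le p_pr k0; rewrite -/N => H.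
  have : (p ^ 1 <= p ^ logn p 'C(N, k))%N by rewrite leq_exp2l ?prime_gt1.
  by rewrite expn1; lia.
set m := maxn 'C(N, k) N.
rewrite -{1}(partnT C0) (@widen_partn m) ?leq_maxl//=.
have -> : (\sum_(1 <= p < N.+1 | prime p) 1 =
           \sum_(0 <= p < m.+1) (prime p && (p <= N)))%N.
  rewrite [RHS](big_cat_nat (n := N.+1))//=; last by rewrite ltnS leq_maxr.
  rewrite [X in (_ + X)%N]big_nat [X in (_ + X)%N]big1 ?addn0; last first.
    by move=> p /andP[Np _]; rewrite leqNgt Np andbF.
  rewrite [RHS]big_ltn//= add0n big_mkcond/= big_nat [RHS]big_nat.
  by apply: eq_bigr => p /andP[_]; rewrite ltnS => ->; case: (prime p).
rewrite expn_sum; apply: leq_prod => p _.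
case: (boolP (prime p)) => [p_pr|p_npr]; last first.
  by rewrite /logn (negbTE p_npr).
case: (leqP p N) => [pN|Np]; last by rewrite Hp.
by rewrite expn1; exact: logn_bin_le.
Qed.

(** For the binomial coefficient of 2^(k+1) over 2^k, the base of the previous
    bound is a power of two, so that comparing exponents replaces taking
    logarithms. *)
Lemma chebyshev_pow2 k :
  (2 ^ k <= k.+1 * \sum_(1 <= p < (2 ^ k.+1).+1 | prime p) 1)%N.
Proof.
have k0 : (0 < 2 ^ k)%N by rewrite expn_gt0.
have := leq_trans (expn2_le_bin (2 ^ k)) (bin_le_exp_primes k0).
rewrite -mul2n -expnS -expnM leq_exp2l//.
Qed.

(** * Powers and the growth of the frequencies *)

(** Bernoulli's inequality for a concave power: the graph lies below its tangent
    at 1. After dividing by u^c with u = exp t, it is the convex combination,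
    with weights 1 - c and c, of exp s >= 1 + s at s = - c t and s = (1 - c) t,
    where the linear terms cancel. *)
Lemma powR_le_tangent (R : realType) (c u : R) :
  0 <= c <= 1 -> 0 <= u -> u `^ c <= 1 + c * (u - 1).
Proof.
move=> /andP[c0 c1]; rewrite le_eqVlt => /predU1P[<-|u0].
  case: (eqVneq c 0) => [->|cn0]; first by rewrite powRr0; lra.
  by rewrite powR0//; lra.
have -> : u = expR (ln u) by rewrite lnK.
set t := ln u; rewrite -expRM.
have E1 : expR ((1 - c) * t) * expR (t * c) = expR t.
  by rewrite -expRD; congr expR; ring.
have E2 : expR (- (c * t)) * expR (t * c) = 1.
  by rewrite -expRD -[RHS]expR0; congr expR; ring.
have h1 := expR_ge1Dx ((1 - c) * t).
have h2 := expR_ge1Dx (- (c * t)).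
have w0 := expR_gt0 (t * c).
have : 1 <= c * expR ((1 - c) * t) + (1 - c) * expR (- (c * t)) by nra.
rewrite -(ler_pM2r w0) mul1r mulrDl -!mulrA E1 E2; lra.
Qed.

Lemma powRB_gt0 (R : realType) (x r s : R) :
  0 < x -> x `^ (r - s) = x `^ r / x `^ s.
Proof. by move=> x0; rewrite powRB// (gt_eqF x0) implybT. Qed.

Lemma powRD_gt0 (R : realType) (x r s : R) :
  0 < x -> x `^ (r + s) = x `^ r * x `^ s.
Proof. by move=> x0; rewrite powRD// (gt_eqF x0) implybT. Qed.

(** The tangent inequality rescaled by y: a mean value estimate with the smallest
    value of the derivative. It serves both to telescope the sum of n^(-a) and
    to separate the exponents n^c. *)
Lemma powR_sub_ge (R : realType) (c x y : R) :
  0 <= c <= 1 -> 0 <= x -> 0 < y ->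
  c * y `^ (c - 1) * (y - x) <= y `^ c - x `^ c.
Proof.
move=> c01 x0 y0.
have u0 : 0 <= x / y by rewrite divr_ge0// ltW.
have := powR_le_tangent c01 u0.
have yc0 := powR_gt0 c y0.
rewrite -(ler_pM2r yc0) -(powRM _ u0 (ltW y0)) divfK ?gt_eqF// => H.
rewrite powRB_gt0// (powRr1 (ltW y0)).
have -> : c * (y `^ c / y) * (y - x) = y `^ c - (1 + c * (x / y - 1)) * y `^ c.
  by field; rewrite gt_eqF.
lra.
Qed.

Lemma sum_powRN_le (R : realType) (a : R) N : 0 <= a < 1 ->
  \sum_(1 <= n < N.+1) n%:R `^ (- a) <= N%:R `^ (1 - a) / (1 - a).
Proof.
move=> /andP[a0 a1].
have d0 : 0 < 1 - a by lra.
elim: N => [|N IH].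
  by rewrite big_geq// divr_ge0 ?powR_ge0// ltW.
rewrite big_nat_recr//=; apply: (le_trans (lerD IH (lexx _))).
have c01 : 0 <= 1 - a <= 1 by lra.
have := powR_sub_ge c01 (ler0n R N) (ltr0Sn R N).
rewrite (_ : 1 - a - 1 = - a); last by ring.
rewrite (_ : N.+1%:R - N%:R = 1); last by rewrite -natr1; ring.
rewrite mulr1 => H.
rewrite -lerBrDl -mulrBl ler_pdivlMr// mulrC; exact: H.
Qed.

(** Increments of t^b dominate those of t^c on the naturals, because
    t^b = t^c t^(b-c) and the second factor is nondecreasing and at least 1 for
    t >= 1. This reduces all b > a to an exponent below 1. *)
Lemma powR_sub_le (R : realType) (b c : R) (m n : nat) : 0 < c <= b ->
  (m <= n)%N ->
  n%:R `^ c - m%:R `^ c <= n%:R `^ b - m%:R `^ b.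
Proof.
move=> /andP[c0 cb] mn.
have b0 : 0 < b by lra.
case: m mn => [|m] mn.
  rewrite !powR0 ?gt_eqF// !subr0.
  case: n mn => [|n] _; first by rewrite !powR0 ?gt_eqF.
  by apply: ler_powR => //; rewrite ler1n.
have E k : (0 < k)%N -> k%:R `^ b = k%:R `^ c * k%:R `^ (b - c) :> R.
  move=> k0; rewrite -powRD; first by congr powR; ring.
  by rewrite pnatr_eq0 -lt0n k0 implybT.
rewrite !E//; last by lia.
have H1 : m.+1%:R `^ c <= n%:R `^ c :> R.
  by apply: ge0_ler_powR; rewrite ?nnegrE ?ler0n ?ler_nat// ltW.
have H2 : m.+1%:R `^ (b - c) <= n%:R `^ (b - c) :> R.
  by apply: ge0_ler_powR; rewrite ?subr_ge0 ?nnegrE ?ler0n ?ler_nat.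
have H3 : 1 <= m.+1%:R `^ (b - c) :> R.
  by rewrite -[X in X <= _](powRr0 m.+1%:R) ler_powR ?ler1n ?subr_ge0.
have H4 := powR_ge0 (n%:R : R) c.
move: H1 H2 H3 H4.
set u := _ `^ _; set v := _ `^ _; set w := _ `^ _; set z := _ `^ _.
nra.
Qed.

(** With t = c ln(alpha) n^(c-1), the ratio is at most exp (- t (n - m)), and
    the geometric series is at most 1 / (1 - exp (- t)) <= 1 + 1 / t. *)
Lemma sum_ratio_le (R : realType) (alpha b c : R) (n : nat) :
  1 < alpha -> 0 < c <= b -> c <= 1 -> (0 < n)%N ->
  \sum_(1 <= m < n.+1) alpha `^ (m%:R `^ b) / alpha `^ (n%:R `^ b)
    <= (1 + (c * ln alpha)^-1) * n%:R `^ (1 - c).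
Proof.
move=> al1 /andP[c0 cb] c1 n0.
have al0 : 0 < alpha by lra.
have l0 := ln_gt0 al1.
have n0R : 0 < n%:R :> R by rewrite ltr0n.
pose t := c * ln alpha * n%:R `^ (c - 1).
have t0 : 0 < t by rewrite !mulr_gt0// powR_gt0.
have nc1 : 1 <= n%:R `^ (1 - c) :> R.
  by rewrite -[X in X <= _](powRr0 n%:R) ler_powR ?ler1n ?subr_ge0.
have tE : t^-1 = (c * ln alpha)^-1 * n%:R `^ (1 - c).
  by rewrite /t invfM -powRN opprB.
apply: (@le_trans _ _ (1 + t^-1)); last by rewrite tE; lra.
pose r := expR (- t).
have r0 : 0 < r := expR_gt0 _.
have rle : r <= (1 + t)^-1.
  by rewrite /r expRN lef_pV2 ?posrE ?expR_gt0 ?expR_ge1Dx//; lra.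
have r1 : r < 1.
  by rewrite /r -expR0 ltr_expR; lra.
apply: (@le_trans _ _ (1 - r)^-1); last first.
  have ti0 : 0 < t^-1 by rewrite invr_gt0.
  rewrite -[leRHS]invrK lef_pV2 ?posrE ?invr_gt0; [|lra|lra].
  apply: (@le_trans _ _ (1 - (1 + t)^-1)); last by lra.
  rewrite le_eqVlt; apply/orP; left; apply/eqP; field.
  by rewrite !gt_eqF//; lra.
apply: (@le_trans _ _ (\sum_(1 <= m < n.+1) r ^+ (n - m))).
  rewrite big_nat [X in _ <= X]big_nat; apply: ler_sum => m /andP[_ mn].
  rewrite -powRB_gt0// [X in X <= _]/powR gt_eqF// -expRM_natl ler_expR.
  have c01 : 0 <= c <= 1 by lra.
  have cb' : 0 < c <= b by lra.
  have H1 := powR_sub_le cb' (mn : (m <= n)%N).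
  have H2 := powR_sub_ge c01 (ler0n R m) n0R.
  rewrite natrB//.
  have H3 := le_trans H2 H1.
  have := ler_wpM2r (ltW l0) H3.
  rewrite /t; lra.
rewrite (_ : \sum_(1 <= m < n.+1) r ^+ (n - m) = \sum_(0 <= i < n) r ^+ i).
  have := subrX1 r n; rewrite big_mkord.
  set s := \sum_(i < n) _ => E.
  rewrite -[leRHS]div1r ler_pdivlMr ?subr_gt0//.
  have := exprn_gt0 n r0; lra.
rewrite big_add1 big_nat_rev/= big_nat [RHS]big_nat.
by apply: eq_bigr => i /andP[_ ni]; congr (_ ^+ _); lia.
Qed.

(** The crude bound alpha^u >= u ln(alpha) is enough here: it leaves a sum of
    m^(-c), which has the same size N^(1-c) as the bound on the ratios. *)
Lemma sum_inv_le (R : realType) (alpha b c : R) (N : nat) :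
  1 < alpha -> 0 < c <= b -> c < 1 ->
  \sum_(1 <= m < N.+1) (alpha `^ (m%:R `^ b))^-1
    <= (ln alpha * (1 - c))^-1 * N%:R `^ (1 - c).
Proof.
move=> al1 /andP[c0 cb] c1.
have al0 : 0 < alpha by lra.
have l0 := ln_gt0 al1.
apply: (@le_trans _ _ (\sum_(1 <= m < N.+1) (ln alpha)^-1 * m%:R `^ (- c))).
  rewrite big_nat [X in _ <= X]big_nat; apply: ler_sum => m /andP[m1 _].
  rewrite powRN -invfM lef_pV2 ?posrE ?powR_gt0 ?mulr_gt0 ?powR_gt0 ?ltr0n//.
  rewrite [leRHS]/powR gt_eqF//; apply: (le_trans _ (expR_ge1Dx _)).
  have : m%:R `^ c <= m%:R `^ b :> R by apply: ler_powR => //; rewrite ler1n.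
  nra.
rewrite -mulr_sumr invfM -mulrA ler_pM2l ?invr_gt0// mulrC.
by apply: sum_powRN_le; lra.
Qed.

(** * Points whose dilate is close to an integer *)

(** For x > 0 these are the y for which the fractional part of x y + s is less
    than d (when d <= 1). With s = 0 this is a one-sided approximation; with
    s = d and length 2 d it contains the two-sided one. Writing it as a
    union of intervals makes it visibly Borel. *)
Definition near_int (R : realType) (x s d : R) : set R :=
  \bigcup_(m in [set: int]) `[(m%:~R - s) / x, (m%:~R - s + d) / x[%classic.

Lemma near_intP (R : realType) (x s d y : R) : 0 < x ->
  near_int x s d y <-> exists m : int, m%:~R <= x * y + s < m%:~R + d.
Proof.
move=> x0; split => [[m _]|[m /andP[H1 H2]]].
  rewrite /= in_itv/= ler_pdivrMr// ltr_pdivlMr// => /andP[H1 H2].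
  by exists m; apply/andP; split; lra.
exists m => //=; rewrite in_itv/= ler_pdivrMr// ltr_pdivlMr//.
by apply/andP; split; lra.
Qed.

Lemma measurable_near_int (R : realType) (x s d : R) :
  measurable (near_int x s d).
Proof. exact: countable_bigcupT_measurable. Qed.

Lemma lebesgue_measure_cc (R : realType) (u v : R) : u <= v ->
  lebesgue_measure `[u, v]%classic = (v - u)%:E.
Proof.
move=> uv; rewrite lebesgue_measure_itv/= lte_fin.
by case: ltP => // vu; rewrite (le_anti (_ : u <= v <= u)) ?subrr// uv.
Qed.

(** In a window of length v - u, the integer m attached to a point lies in an
    interval of length x (v - u) + d, whence the number K of intervals. *)
Lemma near_int_cover (R : realType) (x s d u v : R) :
  0 < x -> 0 < d -> u <= v ->
  exists (K : nat) (c : R), K%:R <= x * (v - u) + d + 1 /\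
    near_int x s d `&` `[u, v] `<=`
      \bigcup_(i < K) `[(c + i%:R) / x, (c + i%:R + d) / x]%classic.
Proof.
move=> x0 d0 uv.
(* The admissible integers are those m with lo < m <= hi. *)
set lo := Num.floor (x * u + s - d); set hi := Num.floor (x * v + s).
have lohi : lo <= hi.
  by apply: le_floor; have := ler_wpM2l (ltW x0) uv; lra.
have hiE := floor_le (x * v + s).
have loE := floorD1_gt (x * u + s - d).
rewrite -/lo -/hi in hiE loE.
have KE : (`|hi - lo|%N%:R : R) = hi%:~R - lo%:~R.
  by rewrite natr_absz ger0_norm ?subr_ge0// intrB.
exists `|hi - lo|%N, (lo%:~R + 1 - s); split.
  by rewrite KE; rewrite intrD in loE; lra.
move=> y [/(near_intP _ _ _ x0)[m /andP[H1 H2]]].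
rewrite /= in_itv/= => /andP[uy yv].
have Hu := ler_wpM2l (ltW x0) uy; have Hv := ler_wpM2l (ltW x0) yv.
have mhi : m <= hi by rewrite floor_ge_int; lra.
have lom : lo + 1 <= m by rewrite lezD1 floor_lt_int; lra.
exists `|(m - lo - 1)%R|%N => /=; first by lia.
have -> : (`|(m - lo - 1)%R|%N%:R : R) = m%:~R - lo%:~R - 1.
  by rewrite natr_absz ger0_norm ?intrB//; lia.
by rewrite in_itv/= ler_pdivrMr// ler_pdivlMr//; apply/andP; split; lra.
Qed.

(** The common source of the measure of one set and of the intersection of two:
    the bound [beta] on a single interval of the cover is multiplied by the
    number of intervals. *)
Lemma near_int_setI_le (R : realType) (x s d u v beta : R) (B : set R) :
  0 < x -> 0 < d -> u <= v -> measurable B ->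
  (forall p q, q = p + d / x -> (lebesgue_measure (B `&` `[p, q]) <= beta%:E)%E) ->
  (lebesgue_measure (near_int x s d `&` B `&` `[u, v])
    <= ((x * (v - u) + d + 1) * beta)%:E)%E.
Proof.
move=> x0 d0 uv mB HB.
have [K [c [HK cov]]] := near_int_cover s x0 d0 uv.
have beta0 : 0 <= beta.
  by rewrite -lee_fin; apply: le_trans (HB 0 (0 + d / x) erefl).
have mI (p q : R) : measurable (B `&` `[p, q]) by exact: measurableI.
pose I (i : nat) : set R := B `&` `[(c + i%:R) / x, (c + i%:R + d) / x].
apply: (@le_trans _ _ (lebesgue_measure (\big[setU/set0]_(i < K) I i))).
  apply: le_measure; rewrite ?inE.
  - by do 2 apply: measurableI => //; exact: measurable_near_int.
  - by apply: bigsetU_measurable => i _; exact: mI.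
  - rewrite -bigcup_mkord => y [[Hy By] uvy].
    by have [i Ki Hi] := cov y (conj Hy uvy); exists i.
apply: (le_trans (Boole_inequality _ _)) => [i _|]; first exact: mI.
apply: (@le_trans _ _ (\sum_(i < K) beta%:E)%E).
  by apply: lee_sum => i _; apply: HB; ring.
rewrite sumEFin sumr_const card_ord lee_fin -[leLHS]mulr_natl.
exact: ler_wpM2r.
Qed.

(** The main term is d (v - u); the other term, of order one interval of length
    d / x, accounts for the incomplete periods at the ends. *)
Lemma near_int_measure_le (R : realType) (x s d u v : R) :
  0 < x -> 0 < d -> u <= v ->
  (lebesgue_measure (near_int x s d `&` `[u, v])
    <= (d * (v - u) + d * (d + 1) / x)%:E)%E.
Proof.
move=> x0 d0 uv; rewrite -[near_int _ _ _]setIT.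
have -> : d * (v - u) + d * (d + 1) / x = (x * (v - u) + d + 1) * (d / x).
  by field; rewrite gt_eqF.
apply: near_int_setI_le => // p q ->; rewrite setTI.
rewrite lebesgue_measure_cc; first by rewrite lee_fin; lra.
by have : 0 < d / x; [exact: divr_gt0|lra].
Qed.

(** Quasi-independence: the first set is covered by about x1 intervals of length
    d1 / x1, on each of which the second set has relative density d2 up to the
    end effect d2 / x2. The main term is d1 d2, the error is of order
    d2 x1 / x2 when x1 >= 1. *)
Lemma near_int_pair_le (R : realType) (x1 s1 d1 x2 s2 d2 u v : R) :
  0 < x1 -> 0 < d1 -> 0 < x2 -> 0 < d2 -> u <= v ->
  (lebesgue_measure (near_int x1 s1 d1 `&` near_int x2 s2 d2 `&` `[u, v])
    <= ((x1 * (v - u) + d1 + 1) * (d2 * (d1 / x1) + d2 * (d2 + 1) / x2))%:E)%E.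
Proof.
move=> x10 d10 x20 d20 uv; apply: near_int_setI_le => //.
  exact: measurable_near_int.
move=> p q qE.
have dx : 0 < d1 / x1 by exact: divr_gt0.
have -> : d1 / x1 = q - p by rewrite qE; ring.
by apply: near_int_measure_le => //; lra.
Qed.

(** Of the unit interval only the floor (x) complete periods are used; the loss
    of at most one period costs d / x. *)
Lemma near_int_measure_ge (R : realType) (x d : R) :
  0 < x -> 0 < d <= 1 ->
  ((d - d / x)%:E <= lebesgue_measure (near_int x 0 d `&` `[0%R, 1%R]))%E.
Proof.
move=> x0 /andP[d0 d1].
set K := Num.truncn x.
have /andP[K1 K2] : K%:R <= x < K.+1%:R by apply: truncn_itv; exact: ltW.
pose I (i : nat) : set R := `[i%:R / x, (i%:R + d) / x[%classic.
have IE i : lebesgue_measure (I i) = (d / x)%:E.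
  rewrite lebesgue_measure_itv/= lte_fin ltr_pM2r ?invr_gt0// ltrDl d0 -EFinB.
  by congr EFin; ring.
apply: (@le_trans _ _ (lebesgue_measure (\big[setU/set0]_(i < K) I i))).
  rewrite measure_bigsetU; [|by move=> i; exact: measurable_itv|]; last first.
    apply/trivIsetP => i j _ _ ij; apply/seteqP; split => [y []|] //=.
    rewrite /I /= !in_itv/= !ler_pdivrMr// !ltr_pdivlMr//.
    move=> /andP[a1 a2] /andP[b1 b2].
    have : (i%:R < j.+1%:R :> R) by rewrite -natr1; lra.
    have : (j%:R < i.+1%:R :> R) by rewrite -natr1; lra.
    by rewrite !ltr_nat => h1 h2; move: ij; rewrite (_ : i = j) ?eqxx//; lia.
  rewrite (eq_bigr (fun=> (d / x)%:E)) => [|i _]; last exact: IE.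
  rewrite sumEFin sumr_const card_ord lee_fin -[leRHS]mulr_natl.
  have -> : d - d / x = (x - 1) * (d / x) by field; rewrite gt_eqF.
  rewrite ler_pM2r ?divr_gt0//; rewrite -natr1 in K2; lra.
apply: le_measure; rewrite ?inE.
- by apply: bigsetU_measurable => i _; exact: measurable_itv.
- by apply: measurableI => //; exact: measurable_near_int.
rewrite -bigcup_mkord => y [i /= iK].
rewrite /I /= in_itv/= => /andP[i1 i2].
have iK' : i.+1%:R <= K%:R :> R by rewrite ler_nat.
have i0 : 0 <= i%:R :> R by [].
split.
  apply/near_intP => //; exists i%:Z.
  move: i1 i2; rewrite ler_pdivrMr// ltr_pdivlMr// => i1 i2.
  by apply/andP; split; lra.
rewrite in_itv/=; apply/andP; split.
  by apply: le_trans i1; rewrite divr_ge0// ltW.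
apply: (le_trans (ltW i2)); rewrite ler_pdivrMr// mul1r.
rewrite -natr1 in iK'; lra.
Qed.

Lemma dist_int_lt (R : realType) (x d : R) :
  dist_int x < d -> exists m : int, `|x - m%:~R| < d.
Proof.
rewrite /dist_int => /inf_lt[]; last by move=> _ [m _ <-] H; exists m.
by exists `|x - 0%:~R|; exists 0.
Qed.

Lemma dist_int_le (R : realType) (x : R) (m : int) :
  dist_int x <= `|x - m%:~R|.
Proof.
apply: ge_inf; last by exists m.
by exists 0 => _ [k _ <-].
Qed.

Lemma near_int_dist_lt (R : realType) (x d y : R) : 0 < x ->
  near_int x 0 d y -> dist_int (x * y) < d.
Proof.
move=> x0 /(near_intP _ _ _ x0)[m /andP[H1 H2]].
by apply: (le_lt_trans (dist_int_le _ m)); rewrite ger0_norm; lra.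
Qed.

Lemma dist_lt_near_int (R : realType) (x d y : R) : 0 < x ->
  dist_int (x * y) < d -> near_int x d (2 * d) y.
Proof.
move=> x0 /dist_int_lt[m]; rewrite ltr_norml => /andP[H1 H2].
by apply/near_intP => //; exists m; apply/andP; split; lra.
Qed.

(** * First and second moments of counting functions *)

(** The sum over k of the [f k] has finite integral, so it is finite almost
    everywhere, and it dominates each of its terms. *)
Lemma ae_bounded_of_sum_integral d (T : measurableType d) (R : realType)
    (mu : {measure set T -> \bar R}) (D : set T) (f : nat -> T -> R)
    (u : nat -> R) (B : R) :
  measurable D -> (forall k, measurable_fun D (f k)) ->
  (forall k x, 0 <= f k x) ->
  (forall k, (\int[mu]_(x in D) (f k x)%:E <= (u k)%:E)%E) ->
  (forall n, \sum_(0 <= k < n) u k <= B) ->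
  {ae mu, forall x, D x -> exists C : R, forall k, f k x <= C}.
Proof.
move=> mD mf f0 fu uB.
pose F x := (\sum_(k <oo) (f k x)%:E)%E.
have mEf k : measurable_fun D (EFin \o f k) by exact/measurable_EFinP.
have F0 x : (0 <= F x)%E by apply: nneseries_ge0 => k _ _; rewrite lee_fin.
have mF : measurable_fun D F.
  have H k x : D x -> predT k -> (0 <= (f k x)%:E)%E by rewrite lee_fin.
  exact: (ge0_emeasurable_sum H (fun k _ => mEf k)).
have intF : mu.-integrable D F.
  apply/integrableP; split => //.
  rewrite (eq_integral F); last by move=> x _; rewrite gee0_abs.
  rewrite integral_nneseries//; last by move=> k x _; rewrite lee_fin.
  apply: (@le_lt_trans _ _ B%:E); last exact: ltry.
  apply: lime_le.
    apply: is_cvg_nneseries => k _ _; apply: integral_ge0 => x _.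
    by rewrite lee_fin.
  apply: nearW => n; apply: (le_trans (lee_sum _ (fun k _ => fu k))).
  by rewrite sumEFin lee_fin.
have := integrable_ae mD intF.
apply: filterS => x Fx Dx; exists (fine (F x)) => k.
rewrite -lee_fin fineK; last exact: Fx.
have : ((\sum_(0 <= i < k.+1) (f i x)%:E)%R <= F x)%E.
  by apply: nneseries_lim_ge => n _ _; rewrite lee_fin.
apply: le_trans; rewrite sumEFin lee_fin big_nat_recr//= lerDr.
exact: sumr_ge0.
Qed.

(** Expanding the square, with lower bounds [p] for the linear term and upper
    bounds [q] for the quadratic one. The constant [M] need not be the mean:
    in the application it is the nominal mean, which has a simple formula. *)
Lemma integral_sqr_count_sub_le d (T : measurableType d) (R : realType)
    (mu : {measure set T -> \bar R}) (D : set T) (r : seq nat)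
    (F : nat -> set T) (M : R) (p : nat -> R) (q : nat -> nat -> R) :
  measurable D -> mu D = 1%E -> (forall i, measurable (F i)) -> 0 <= M ->
  (forall i, i \in r -> ((p i)%:E <= mu (F i `&` D))%E) ->
  (forall i j, i \in r -> j \in r ->
     (mu (F i `&` F j `&` D) <= (q i j)%:E)%E) ->
  (\int[mu]_(x in D) ((\sum_(i <- r) \1_(F i) x - M) ^+ 2)%:E <=
    (\sum_(i <- r) \sum_(j <- r) q i j - 2 * M * (\sum_(i <- r) p i)
      + M ^+ 2)%:E)%E.
Proof.
move=> mD muD mF M0 Hp Hq.
pose S x : R := \sum_(i <- r) \1_(F i) x.
have S0 x : 0 <= S x by apply: sumr_ge0.
have mS : measurable_fun D S by apply: measurable_sum => i; exact: measurable_indic.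
have mEF i : measurable_fun D (EFin \o (\1_(F i) : T -> R)).
  by apply/measurable_EFinP; exact: measurable_indic.
have mV : measurable_fun D (EFin \o (fun x => (S x - M) ^+ 2)).
  by apply/measurable_EFinP; apply: measurable_funX; apply: measurable_funB.
have mES : measurable_fun D (EFin \o S) by exact/measurable_EFinP.
have mES2 : measurable_fun D (EFin \o (fun x => S x ^+ 2)).
  by apply/measurable_EFinP; apply: measurable_funX.
have intS : (\int[mu]_(x in D) (S x)%:E = \sum_(i <- r) mu (F i `&` D))%E.
  under eq_integral do rewrite -sumEFin.
  rewrite ge0_integral_sum//.
  by apply: eq_bigr => i _; rewrite integral_indic.
have intS2 : (\int[mu]_(x in D) (S x ^+ 2)%:E =
    \sum_(i <- r) \sum_(j <- r) mu (F i `&` F j `&` D))%E.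
  have E x : ((S x ^+ 2)%:E = \sum_(i <- r) \sum_(j <- r)
      (\1_(F i `&` F j) x : R)%:E)%E.
    rewrite expr2 {1}/S mulr_suml -sumEFin; apply: eq_bigr => i _.
    rewrite /S mulr_sumr -sumEFin; apply: eq_bigr => j _.
    by rewrite indicI.
  under eq_integral do rewrite E.
  have mEFF i j : measurable_fun D (EFin \o (\1_(F i `&` F j) : T -> R)).
    by apply/measurable_EFinP; apply: measurable_indic; exact: measurableI.
  have mEFF' i : measurable_fun D
      (fun x => \sum_(j <- r) (\1_(F i `&` F j) x : R)%:E)%E.
    by apply: emeasurable_sum => j; exact: mEFF.
  have ind0 (A : set T) x : D x -> (0 <= (\1_A x : R)%:E)%E by rewrite lee_fin.
  rewrite (ge0_integral_sum _ _ mEFF')//; last first.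
    by move=> i x _; apply: sume_ge0 => j _; rewrite lee_fin.
  apply: eq_bigr => i _.
  rewrite (ge0_integral_sum _ _ (mEFF i) (fun j => ind0 _))//.
  by apply: eq_bigr => j _; rewrite integral_indic//; exact: measurableI.
(* The identity (S - M)^2 + 2 M S = S^2 + M^2 has only nonnegative terms, so
   additivity of the integral applies without integrability conditions. *)
have key : (\int[mu]_(x in D) ((S x - M) ^+ 2)%:E +
    (2 * M)%:E * \int[mu]_(x in D) (S x)%:E =
    \int[mu]_(x in D) (S x ^+ 2)%:E + (M ^+ 2)%:E)%E.
  have -> : ((M ^+ 2)%:E = \int[mu]_(x in D) (cst (M ^+ 2)%:E x))%E.
    by rewrite integral_cst// muD mule1.
  have S0' x : D x -> (0 <= (S x)%:E)%E by rewrite lee_fin.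
  have M2 : 0 <= 2 * M by rewrite mulr_ge0.
  rewrite -(ge0_integralZl_EFin _ _ S0' mES M2)//.
  have V0 x : D x -> (0 <= ((S x - M) ^+ 2)%:E)%E by rewrite lee_fin sqr_ge0.
  have MS0 x : D x -> (0 <= (2 * M)%:E * (S x)%:E)%E.
    by rewrite -EFinM lee_fin mulr_ge0.
  have S20 x : D x -> (0 <= (S x ^+ 2)%:E)%E by rewrite lee_fin sqr_ge0.
  have C0 x : D x -> (0 <= cst (M ^+ 2)%:E x)%E by rewrite lee_fin sqr_ge0.
  rewrite -(ge0_integralD _ mD V0 mV MS0 (measurable_funeM _ mES)).
  rewrite -(ge0_integralD _ mD S20 mES2 C0 (measurable_cst _)).
  by apply: eq_integral => x _; rewrite -EFinM -!EFinD; congr EFin; ring.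
have E3 (a b c : R) : ((a - b + c)%:E = (a%:E + c%:E) - b%:E)%E.
  by rewrite -[RHS]/((a + c - b)%:E); congr EFin; ring.
rewrite E3.
rewrite leeBrDr//.
apply: (@le_trans _ _ (\int[mu]_(x in D) ((S x - M) ^+ 2)%:E +
    (2 * M)%:E * \int[mu]_(x in D) (S x)%:E)%E).
  apply: leeD => //; rewrite EFinM lee_wpmul2l// ?lee_fin ?mulr_ge0//.
  rewrite intS -sumEFin big_seq [leRHS]big_seq.
  by apply: lee_sum.
rewrite key intS2; apply: leeD => //.
rewrite -sumEFin big_seq [leRHS]big_seq; apply: lee_sum => i ir.
rewrite -sumEFin big_seq [leRHS]big_seq; apply: lee_sum => j jr.
exact: Hq.
Qed.

Lemma measurable_fun_count d (T : measurableType d) (R : realType)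
    (D : set T) (r : seq nat) (F : nat -> set T) :
  (forall i, measurable (F i)) ->
  measurable_fun D (fun x => \sum_(i <- r) \1_(F i) x : R).
Proof. by move=> mF; apply: measurable_sum => i; exact: measurable_indic. Qed.

Lemma measurable_fun_sqr_count_sub d (T : measurableType d) (R : realType)
    (D : set T) (r : seq nat) (F : nat -> set T) (M : R) :
  (forall i, measurable (F i)) ->
  measurable_fun D (fun x => (\sum_(i <- r) \1_(F i) x - M) ^+ 2).
Proof.
move=> mF; apply: measurable_funX; apply: measurable_funB => //.
exact: measurable_fun_count.
Qed.

Lemma integral_count_le d (T : measurableType d) (R : realType)
    (mu : {measure set T -> \bar R}) (D : set T) (r : seq nat)
    (F : nat -> set T) (p : nat -> R) :
  measurable D -> (forall i, measurable (F i)) ->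
  (forall i, i \in r -> (mu (F i `&` D) <= (p i)%:E)%E) ->
  (\int[mu]_(x in D) (\sum_(i <- r) \1_(F i) x)%:E <= (\sum_(i <- r) p i)%:E)%E.
Proof.
move=> mD mF Hp; under eq_integral do rewrite -sumEFin.
rewrite ge0_integral_sum//; last first.
  by move=> i; apply/measurable_EFinP; exact: measurable_indic.
rewrite -sumEFin big_seq [leRHS]big_seq; apply: lee_sum => i ir.
by rewrite integral_indic// Hp.
Qed.

(** The weights [w] carry the normalisation of the counts; keeping them apart
    from [f] lets the integrals be estimated before normalising. *)
Lemma ae_weighted_bounded d (T : measurableType d) (R : realType)
    (mu : {measure set T -> \bar R}) (D : set T) (f : nat -> T -> R)
    (w u : nat -> R) (B : R) :
  measurable D -> (forall k, measurable_fun D (f k)) ->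
  (forall k x, 0 <= f k x) -> (forall k, 0 <= w k) ->
  (forall k, (\int[mu]_(x in D) (f k x)%:E <= (u k)%:E)%E) ->
  (forall n, \sum_(0 <= k < n) w k * u k <= B) ->
  {ae mu, forall x, D x -> exists C : R, forall k, w k * f k x <= C}.
Proof.
move=> mD mf f0 w0 fu uB.
apply: (@ae_bounded_of_sum_integral _ _ _ mu D (fun k x => w k * f k x)
  (fun k => w k * u k) B) => //.
- by move=> k; apply: measurable_funM => //; exact: measurable_cst.
- by move=> k x; rewrite mulr_ge0.
- move=> k; under eq_integral do rewrite EFinM.
  have mEf : measurable_fun D (EFin \o f k) by exact/measurable_EFinP.
  have Ef0 x : D x -> (0 <= (f k x)%:E)%E by rewrite lee_fin.
  rewrite (ge0_integralZl_EFin _ mD Ef0 mEf (w0 k)).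
  by rewrite EFinM lee_wpmul2l// lee_fin.
Qed.

(** The pairs i <= j contribute d_i d_j plus an error of order
    d_i d_j / x_i + d_j x_i / x_j. The main terms add up to M^2 and cancel
    against the square of the mean; both error terms, and the difference
    between M and the true mean, sum to O(M T0). *)
Lemma near_int_variance (R : realType) (x d : nat -> R) (r : seq nat) (T0 : R) :
  (forall i, i \in r -> 1 <= x i) -> (forall i, i \in r -> 0 < d i <= 1) ->
  \sum_(i <- r) (x i)^-1 <= T0 ->
  (forall j, j \in r -> \sum_(i <- r | (i <= j)%N) x i / x j <= T0) ->
  let M := \sum_(i <- r) d i in
  (\int[lebesgue_measure]_(y in `[0%R, 1%R])
     ((\sum_(i <- r) \1_(near_int (x i) 0 (d i)) y - M) ^+ 2)%:E
   <= (18 * M * T0)%:E)%E.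
Proof.
move=> x1 d01 HT HT2 /=; set M := \sum_(i <- r) d i.
have x0 i : i \in r -> 0 < x i by move=> /x1; lra.
have M0 : 0 <= M.
  by rewrite /M big_seq sumr_ge0// => i /d01 /andP[/ltW].
pose e i j := 2 * (d i * d j / x i) + 6 * (d j * (x i / x j)).
have e0 i j : i \in r -> j \in r -> 0 <= e i j.
  move=> ir jr; have /andP[di _] := d01 _ ir; have /andP[dj _] := d01 _ jr.
  have xi := x0 _ ir; have xj := x0 _ jr.
  by rewrite addr_ge0// mulr_ge0// ?mulr_ge0 ?invr_ge0 ?ltW.
(* Symmetrised so that q bounds every ordered pair: the error is always that
   of the pair listed in increasing order. *)
pose q i j := d i * d j + ((if (i <= j)%N then e i j else 0)
                         + (if (j <= i)%N then e j i else 0)).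
pose p i := d i - d i * (x i)^-1.
have pairE i j : i \in r -> j \in r ->
    (lebesgue_measure (near_int (x i) 0 (d i) `&` near_int (x j) 0 (d j)
       `&` `[0%R, 1%R]) <= (d i * d j + e i j)%:E)%E.
  move=> ir jr; have /andP[di di1] := d01 _ ir; have /andP[dj dj1] := d01 _ jr.
  have xi := x0 _ ir; have xj := x0 _ jr; have xi1 := x1 _ ir.
  apply: (le_trans (near_int_pair_le 0 0 xi di xj dj ler01)).
  rewrite lee_fin subr0 mulr1 /e.
  apply: (@le_trans _ _ ((x i + 2) * (d j * (d i / x i) + 2 * (d j / x j)))).
    have h1 : 0 < d i / x i by exact: divr_gt0.
    have h2 : 0 < d j / x j by exact: divr_gt0.
    apply: ler_pM.
    - lra.
    - by rewrite addr_ge0// ?mulr_ge0 ?invr_ge0 ?ltW//; lra.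
    - lra.
    - rewrite lerD2l.
      have -> : d j * (d j + 1) / x j = (d j + 1) * (d j / x j) by ring.
      by rewrite ler_pM2r//; lra.
  have -> : (x i + 2) * (d j * (d i / x i) + 2 * (d j / x j)) =
      d i * d j + 2 * (d i * d j / x i) + (2 * x i + 4) * (d j / x j).
    by field; rewrite !gt_eqF.
  rewrite -addrA lerD2l lerD2l.
  have -> : 6 * (d j * (x i / x j)) = (6 * x i) * (d j / x j) by ring.
  by rewrite ler_pM2r ?divr_gt0//; lra.
pose U := \sum_(j <- r) \sum_(i <- r | (i <= j)%N) e i j.
have HU : U <= 8 * (M * T0).
  rewrite /U /M mulr_suml mulr_sumr big_seq [leRHS]big_seq.
  apply: ler_sum => j jr; have /andP[dj _] := d01 _ jr.
  rewrite big_split/= -!mulr_sumr.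
  have -> : 8 * (d j * T0) = 2 * (d j * T0) + 6 * (d j * T0) by ring.
  apply: lerD; rewrite ler_pM2l//; last by rewrite ler_pM2l// HT2.
  apply: (@le_trans _ _ (\sum_(i <- r) d j * (x i)^-1)); last first.
    by rewrite -mulr_sumr ler_pM2l.
  rewrite big_mkcond big_seq [leRHS]big_seq; apply: ler_sum => i ir.
  have /andP[di di1] := d01 _ ir; have xi := x0 _ ir.
  case: ifP => _; last by rewrite ltW// divr_gt0.
  have h : 0 < d j / x i by exact: divr_gt0.
  have -> : d i * d j / x i = d i * (d j / x i) by ring.
  by rewrite -[leRHS]mul1r ler_pM2r.
have Hq : \sum_(i <- r) \sum_(j <- r) q i j = M ^+ 2 + (U + U).
  under eq_bigr do rewrite big_split/= big_split/=.
  rewrite big_split/= big_split/=; congr (_ + (_ + _)).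
  - by rewrite expr2 {1}/M mulr_suml; apply: eq_bigr => i _; rewrite -mulr_sumr.
  - by rewrite exchange_big/=; apply: eq_bigr => j _; rewrite -big_mkcond.
  - by apply: eq_bigr => j _; rewrite -big_mkcond.
have Hp : M - T0 <= \sum_(i <- r) p i.
  rewrite /p sumrB -/M lerD2l lerN2; apply: le_trans HT.
  rewrite big_seq [leRHS]big_seq; apply: ler_sum => i ir.
  have /andP[di di1] := d01 _ ir; have xi := x0 _ ir.
  by rewrite -[leRHS]mul1r ler_pM2r ?invr_gt0.
apply: (le_trans (@integral_sqr_count_sub_le _ _ R lebesgue_measure
   `[0, 1]%classic r (fun i => near_int (x i) 0 (d i)) M p q _ _ _ M0 _ _)).
- exact: measurable_itv.
- by rewrite -[RHS]/(1%:E) -[in RHS](subr0 1); exact: (lebesgue_measure_cc ler01).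
- by move=> i; exact: measurable_near_int.
- by move=> i ir; apply: near_int_measure_ge; [exact: x0|exact: d01].
- move=> i j ir jr; rewrite /q.
  have eij := e0 _ _ ir jr; have eji := e0 _ _ jr ir.
  case: (leqP i j) => ij.
    apply: (le_trans (pairE i j ir jr)); rewrite lee_fin.
    by case: ifP => _; lra.
  rewrite (ltnW ij) add0r (setIC (near_int (x i) _ _)) (mulrC (d i)).
  exact: pairE.
rewrite lee_fin Hq.
have := ler_wpM2l M0 Hp.
nra.
Qed.

(** * Counting primes with weights *)

Definition primes_upto (N : nat) : seq nat :=
  [seq p <- index_iota 1 N.+1 | prime p].

Lemma mem_primes_upto N n :
  (n \in primes_upto N) = [&& prime n, (0 < n)%N & (n <= N)%N].
Proof. by rewrite mem_filter mem_index_iota ltnS. Qed.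

Lemma count_upto_le (R : realType) (A : set nat) (T : Type) (F : nat -> set T)
    (y : T) (N : nat) :
  (forall n, A n -> prime n /\ F n y) ->
  (count_upto A N)%:R <= \sum_(n <- primes_upto N) \1_(F n) y :> R.
Proof.
move=> AF; rewrite /count_upto natr_sum big_filter big_mkcond [leRHS]big_mkcond.
apply: ler_sum => n _; case: ifPn => [/set_mem /AF[-> Fy]|_].
  by rewrite indicE mem_set.
by case: ifP.
Qed.

Lemma count_upto_ge (R : realType) (A : set nat) (T : Type) (F : nat -> set T)
    (y : T) (N : nat) :
  (forall n, (0 < n)%N -> prime n -> F n y -> A n) ->
  \sum_(n <- primes_upto N) \1_(F n) y <= (count_upto A N)%:R :> R.
Proof.
move=> FA; rewrite /count_upto natr_sum big_filter big_mkcond [leRHS]big_mkcond.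
rewrite big_nat [leRHS]big_nat; apply: ler_sum => n /andP[n0 _].
case: ifPn => [n_pr|_]; last by case: ifP.
rewrite indicE; case: (boolP (y \in F n)) => [/set_mem Fy|_].
  by rewrite mem_set//; exact: FA.
by case: ifP.
Qed.

Lemma sum_primes_upto_le (R : realType) (F : nat -> R) (N : nat) :
  (forall n, (0 < n)%N -> 0 <= F n) ->
  \sum_(n <- primes_upto N) F n <= \sum_(1 <= n < N.+1) F n.
Proof.
move=> F0; rewrite big_filter big_mkcond big_nat [leRHS]big_nat.
by apply: ler_sum => n /andP[n0 _]; case: ifP => // _; exact: F0.
Qed.

(** The weight 1 / ((k+1) (k+2)) is a summable sequence whose sum telescopes; it
    makes both families of moments summable at the cost of a factor
    polynomial in k, that is, logarithmic in 2^k. *)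
Lemma sum_inv_prodS_le (R : realType) (n : nat) :
  \sum_(0 <= k < n) (k.+1%:R * k.+2%:R)^-1 <= 1 :> R.
Proof.
suff -> : \sum_(0 <= k < n) (k.+1%:R * k.+2%:R)^-1 = 1 - n.+1%:R^-1 :> R.
  by rewrite lerBlDr lerDl.
elim: n => [|n IH]; first by rewrite big_geq// invr1 subrr.
rewrite big_nat_recr//= IH -(natr1 n.+1) -(natr1 n).
have n0 : 0 <= n%:R :> R by [].
by field; rewrite !gt_eqF//; lra.
Qed.

(** The fourth power absorbs the factors that accompany the variance at
    2^(k+1): the extra weight k+1, the factor k+1 from the density of the
    primes, and the two factors of the summable weight. *)
Lemma pow4_le_expR (R : realType) (eta : R) : 0 < eta ->
  exists2 C : R, 0 < C & forall k : nat, k.+2%:R ^+ 4 <= C * expR (eta * k.+1%:R).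
Proof.
move=> eta0; pose m := Num.min 1 (eta / 4).
have m0 : 0 < m by rewrite lt_min ltr01 divr_gt0.
have [m1 m2] : m <= 1 /\ m <= eta / 4 by rewrite /m !ge_min !lexx orbT.
exists (m ^- 4); first by rewrite invr_gt0 exprn_gt0.
move=> k; rewrite mulrC ler_pdivlMr ?exprn_gt0// -exprMn.
have -> : expR (eta * k.+1%:R) = expR (eta / 4 * k.+1%:R) ^+ 4.
  by rewrite -expRM_natl; congr expR; field.
rewrite lerXn2r ?nnegrE ?expR_ge0//; first by rewrite mulr_ge0// ltW.
apply: le_trans (expR_ge1Dx _).
have k0 : 0 <= k%:R :> R by [].
rewrite -(natr1 k.+1) -(natr1 k); nra.
Qed.

(** Each of the primes up to N contributes at least N^(-a), and there are at
    least N / (2 (k+1)) of them when N = 2^(k+1). *)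
Lemma sum_primes_powRN_ge (R : realType) (a : R) (k : nat) : 0 < a ->
  (2 ^ k.+1)%:R `^ (1 - a) / (2 * k.+1%:R)
    <= \sum_(p <- primes_upto (2 ^ k.+1)) p%:R `^ (- a) :> R.
Proof.
move=> a0; set N := (2 ^ k.+1)%N.
have N0' : (0 < N)%N by rewrite expn_gt0.
have N0 : 0 < N%:R :> R by rewrite ltr0n.
have NE : N%:R = 2 * (2 ^ k)%:R :> R by rewrite /N expnS natrM.
apply: (@le_trans _ _ (\sum_(p <- primes_upto N) N%:R `^ (- a))).
  rewrite big_const_seq count_predT iter_addr_0 -[leRHS]mulr_natl.
  rewrite powRD_gt0// (powRr1 (ltW N0)) -mulrA [_ `^ _ / _]mulrC mulrA.
  rewrite ler_wpM2r ?powR_ge0// NE -mulf_div divff// mul1r ler_pdivrMr//.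
  rewrite -natrM ler_nat mulnC.
  by have := chebyshev_pow2 k; rewrite sum1_count -size_filter.
rewrite big_seq [leRHS]big_seq; apply: ler_sum => p.
rewrite mem_primes_upto => /and3P[_ p0 pN].
rewrite !powRN lef_pV2 ?posrE ?powR_gt0 ?ltr0n//.
by apply: ge0_ler_powR; rewrite ?nnegrE ?ler0n ?ler_nat// ltW.
Qed.

(** * Almost sure bounds along powers of two *)

Lemma powR_powR_ge1 (R : realType) (alpha b : R) (n : nat) :
  1 < alpha -> 1 <= alpha `^ (n%:R `^ b).
Proof.
move=> al1; rewrite -[X in X <= _](powRr0 alpha).
by apply: ler_powR; [exact: ltW|exact: powR_ge0].
Qed.

Lemma powRN_gt0_le1 (R : realType) (a : R) (n : nat) : 0 <= a -> (0 < n)%N ->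
  0 < (n%:R `^ (- a) : R) <= 1.
Proof.
move=> a0 n0; rewrite powR_gt0 ?ltr0n//=.
by rewrite -[leRHS](powRr0 n%:R) ler_powR ?ler1n// oppr_le0.
Qed.

Lemma ae_count_upto_le (R : realType) (a b alpha : R) :
  0 < a < 1 -> 1 < alpha ->
  {ae @lebesgue_measure R, forall y : R, `[0, 1]%classic y ->
    exists C : R, forall k : nat,
      (count_upto (approx_primes a b alpha y) (2 ^ k))%:R
        <= C * (k.+1%:R * k.+2%:R * (2 ^ k)%:R `^ (1 - a))}.
Proof.
move=> /andP[a0 a1] al1.
pose x n : R := alpha `^ (n%:R `^ b); pose d n : R := n%:R `^ (- a).
pose F n := near_int (x n) (d n) (2 * d n).
pose S k y : R := \sum_(n <- primes_upto (2 ^ k)) \1_(F n) y.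
pose w k : R := (k.+1%:R * k.+2%:R * (2 ^ k)%:R `^ (1 - a))^-1.
have w0 k : 0 < w k by rewrite invr_gt0 !mulr_gt0// powR_gt0// ltr0n expn_gt0.
have S0 k y : 0 <= S k y by apply: sumr_ge0.
have x1 n : 1 <= x n by exact: powR_powR_ge1.
have intS k : (\int[lebesgue_measure]_(y in `[0%R, 1%R]) (S k y)%:E
    <= (8 / (1 - a) * (2 ^ k)%:R `^ (1 - a))%:E)%E.
  apply: (@le_trans _ _ (\sum_(n <- primes_upto (2 ^ k)) 8 * d n)%:E).
    apply: integral_count_le.
    - exact: measurable_itv.
    - by move=> n; exact: measurable_near_int.
    move=> n; rewrite mem_primes_upto => /and3P[_ n0 _].
    have /andP[d0 d1] := powRN_gt0_le1 (ltW a0) n0.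
    have x0 : 0 < x n by have := x1 n; lra.
    have d20 : 0 < 2 * d n by rewrite mulr_gt0.
    apply: (le_trans (near_int_measure_le (d n) x0 d20 ler01)).
    rewrite lee_fin subr0 mulr1.
    have -> : 8 * d n = 2 * d n + 6 * d n by ring.
    rewrite lerD2l ler_pdivrMr//.
    have := x1 n; rewrite -/(d n) in d0 d1; nra.
  rewrite lee_fin -mulr_sumr -mulrA ler_pM2l//.
  apply: (le_trans (sum_primes_upto_le _ (fun n _ => powR_ge0 _ _))).
  by rewrite mulrC; apply: sum_powRN_le; lra.
have a10 : 0 < 8 / (1 - a) by rewrite divr_gt0//; lra.
have : {ae @lebesgue_measure R, forall y : R, `[0, 1]%classic y ->
    exists C : R, forall k, w k * S k y <= C}.
  apply: (@ae_weighted_bounded _ _ R lebesgue_measure `[0, 1]%classic S w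
    (fun k => 8 / (1 - a) * (2 ^ k)%:R `^ (1 - a)) (8 / (1 - a))).
  - exact: measurable_itv.
  - by move=> k; apply: measurable_fun_count => n; exact: measurable_near_int.
  - by move=> k y; exact: S0.
  - by move=> k; exact: ltW.
  - exact: intS.
  - move=> n; rewrite (eq_bigr (fun k => 8 / (1 - a) * (k.+1%:R * k.+2%:R)^-1)).
      by rewrite -mulr_sumr -[leRHS]mulr1 ler_pM2l// sum_inv_prodS_le.
    move=> k _; rewrite /w.
    have N0 : (2 ^ k)%:R `^ (1 - a) != 0 :> R.
      by rewrite gt_eqF// powR_gt0// ltr0n expn_gt0.
    by rewrite invfM mulrCA divfK.
apply: (@filterS _ _ (ae_filter_ringOfSetsType (@lebesgue_measure R))).
move=> y Hy y01; have [C HC] := Hy y01; exists C => k.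
have := HC k; rewrite /w mulrC ler_pdivrMr; last first.
  by rewrite !mulr_gt0// powR_gt0// ltr0n expn_gt0.
apply: le_trans; rewrite /S; apply: count_upto_le => n [n_pr yn]; split=> //.
by apply: dist_lt_near_int => //; have := x1 n; lra.
Qed.

Lemma sum_inv_and_ratio_le (R : realType) (alpha b c : R) :
  1 < alpha -> 0 < c <= b -> c < 1 ->
  let x n : R := alpha `^ (n%:R `^ b) in
  exists2 C : R, 0 < C & forall N : nat,
    \sum_(i <- primes_upto N) (x i)^-1 <= C * N%:R `^ (1 - c) /\
    forall j, j \in primes_upto N ->
      \sum_(i <- primes_upto N | (i <= j)%N) x i / x j <= C * N%:R `^ (1 - c).
Proof.
move=> al1 cb c1 x; have /andP[c0 _] := cb.
have l0 := ln_gt0 al1.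
have x0 n : 0 < x n by rewrite powR_gt0//; lra.
pose C1 := (ln alpha * (1 - c))^-1; pose C2 := 1 + (c * ln alpha)^-1.
have C10 : 0 < C1 by rewrite invr_gt0 mulr_gt0//; lra.
have C20 : 0 < C2 by rewrite addr_gt0// invr_gt0 mulr_gt0.
exists (C1 + C2) => [|N]; first exact: addr_gt0.
have N0 := powR_ge0 (N%:R : R) (1 - c).
split.
  apply: (@le_trans _ _ (C1 * N%:R `^ (1 - c))); last first.
    by rewrite ler_wpM2r// lerDl ltW.
  apply: (le_trans (sum_primes_upto_le _ _)) => [n _|].
    by rewrite invr_ge0 ltW.
  exact: sum_inv_le.
move=> j; rewrite mem_primes_upto => /and3P[_ j0 jN].
apply: (@le_trans _ _ (C2 * N%:R `^ (1 - c))); last first.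
  by rewrite ler_wpM2r// lerDr ltW.
apply: (@le_trans _ _ (C2 * j%:R `^ (1 - c))); last first.
  rewrite ler_pM2l//; apply: ge0_ler_powR; rewrite ?nnegrE ?ler0n ?ler_nat//; lra.
apply: le_trans (sum_ratio_le al1 cb (ltW c1) j0).
rewrite [leRHS](@big_nat_widen _ _ _ 1 j.+1 N.+1)//=.
rewrite big_mkcond [leRHS]big_mkcond/=.
apply: (le_trans (sum_primes_upto_le _ _)) => [n _|].
  by case: ifP => // _; rewrite ltW// divr_gt0.
by apply: ler_sum => n _; rewrite ltnS.
Qed.

(** A deviation by more than M / 2 makes the left-hand side exceed (k+1) / 4. The
    factor k+1 is what turns boundedness of the normalised variance terms into
    an inequality valid from some k on. *)
Lemma half_le_of_sqr_le (R : realType) (S M B : R) (k : nat) :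
  0 < M -> 4 * B <= k.+1%:R -> k.+1%:R / M ^+ 2 * (S - M) ^+ 2 <= B -> M / 2 <= S.
Proof.
move=> M0 Bk H; rewrite leNgt; apply/negP => SM.
have k0 : 0 < k.+1%:R :> R by [].
have M20 : 0 < M ^+ 2 by rewrite exprn_gt0.
have : k.+1%:R * (S - M) ^+ 2 <= B * M ^+ 2.
  by rewrite -ler_pdivrMr// -mulrAC.
have h : M ^+ 2 / 4 < (S - M) ^+ 2 by nra.
have : k.+1%:R * (M ^+ 2 / 4) < k.+1%:R * (S - M) ^+ 2 by rewrite ltr_pM2l.
nra.
Qed.

Lemma ae_count_upto_ge (R : realType) (a b alpha : R) :
  0 < a < 1 -> a < b -> 1 < alpha ->
  {ae @lebesgue_measure R, forall y : R, `[0, 1]%classic y ->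
    exists k0 : nat, forall k : nat, (k0 <= k)%N ->
      (2 ^ k.+1)%:R `^ (1 - a)
        <= 4 * k.+1%:R * (count_upto (approx_primes a b alpha y) (2 ^ k.+1))%:R :> R}.
Proof.
move=> /andP[a0 a1] ab al1.
pose x n : R := alpha `^ (n%:R `^ b); pose d n : R := n%:R `^ (- a).
pose F n := near_int (x n) 0 (d n).
pose N k := (2 ^ k.+1)%N.
pose M k : R := \sum_(n <- primes_upto (N k)) d n.
pose S k y : R := \sum_(n <- primes_upto (N k)) \1_(F n) y.
have x1 n : 1 <= x n by exact: powR_powR_ge1.
have N0 k : 0 < (N k)%:R :> R by rewrite ltr0n expn_gt0.
have M_ge k : (N k)%:R `^ (1 - a) / (2 * k.+1%:R) <= M k.
  exact: sum_primes_powRN_ge.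
have M0 k : 0 < M k.
  by apply: lt_le_trans (M_ge k); rewrite divr_gt0 ?powR_gt0// mulr_gt0.
(* The exponent c lies strictly between a and min (1, b): c > a gives decay of
   the normalised variance, c < 1 is needed to sum n^(-c). *)
pose c : R := (a + Num.min 1 b) / 2.
have [c0 cb c1 ac] : [/\ 0 < c, c <= b, c < 1 & a < c].
  have m1 : a < Num.min 1 b by rewrite lt_min a1 ab.
  have m2 : Num.min 1 b <= 1 by rewrite ge_min lexx.
  have m3 : Num.min 1 b <= b by rewrite ge_min lexx orbT.
  by rewrite /c; split; lra.
have cb' : 0 < c <= b by rewrite c0.
have [C C0 HC] := sum_inv_and_ratio_le al1 cb' c1.
have eta0 : 0 < (c - a) * ln 2 by rewrite mulr_gt0 ?subr_gt0// ln_gt0//; lra.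
have [K K0 HK] := pow4_le_expR eta0.
pose T k := C * (N k)%:R `^ (1 - c).
have T0 k : 0 < T k by rewrite mulr_gt0// powR_gt0.
pose w k : R := k.+1%:R / M k ^+ 2.
have w0 k : 0 < w k by rewrite divr_gt0// exprn_gt0.
have intV k : (\int[lebesgue_measure]_(y in `[0%R, 1%R])
    ((S k y - M k) ^+ 2)%:E <= (18 * M k * T k)%:E)%E.
  have [H1 H2] := HC (N k).
  apply: near_int_variance => // i; rewrite mem_primes_upto => /and3P[_ i0 _].
  by apply: powRN_gt0_le1 => //; exact: ltW.
(* The variance bound divided by M^2 is of order (k+1) N^(a-c), which decays
   exponentially in k. *)
have wV k : w k * (18 * M k * T k) <= 36 * C * K * (k.+1%:R * k.+2%:R)^-1.
  have k1 : 0 < k.+1%:R :> R by [].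
  have k2 : 0 < k.+2%:R :> R by [].
  have -> : w k * (18 * M k * T k) = 18 * (k.+1%:R * T k) * (M k)^-1.
    by rewrite /w; field; rewrite gt_eqF.
  apply: (@le_trans _ _ (18 * (k.+1%:R * T k)
      * ((N k)%:R `^ (1 - a) / (2 * k.+1%:R))^-1)).
    rewrite ler_pM2l; last by rewrite mulr_gt0// mulr_gt0.
    by rewrite lef_pV2 ?posrE// divr_gt0 ?powR_gt0// mulr_gt0.
  have E : (N k)%:R `^ (1 - c) / (N k)%:R `^ (1 - a)
      = (expR ((c - a) * ln 2 * k.+1%:R))^-1 :> R.
    rewrite -powRB_gt0// -expRN /powR (gt_eqF (N0 k)); congr expR.
    by rewrite /N natrX lnXn// -mulr_natr; ring.
  have P0 : (N k)%:R `^ (1 - a) != 0 :> R by rewrite gt_eqF// powR_gt0.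
  have -> : 18 * (k.+1%:R * T k) * ((N k)%:R `^ (1 - a) / (2 * k.+1%:R))^-1
      = 36 * C * (k.+1%:R ^+ 2 * ((N k)%:R `^ (1 - c) / (N k)%:R `^ (1 - a))).
    by rewrite /T; field; rewrite P0 gt_eqF.
  rewrite E -[leRHS]mulrA ler_pM2l; last by rewrite mulr_gt0.
  rewrite ler_pdivrMr ?expR_gt0// mulrAC.
  apply: le_trans (ler_wpM2r _ (HK k)); last by rewrite invr_ge0 mulr_ge0.
  rewrite ler_pdivlMr ?mulr_gt0// -(natr1 k.+1).
  nra.
have : {ae @lebesgue_measure R, forall y : R, `[0, 1]%classic y ->
    exists B : R, forall k, w k * (S k y - M k) ^+ 2 <= B}.
  apply: (@ae_weighted_bounded _ _ R lebesgue_measure `[0, 1]%classic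
    (fun k y => (S k y - M k) ^+ 2) w (fun k => 18 * M k * T k) (36 * C * K)).
  - exact: measurable_itv.
  - move=> k; apply: measurable_fun_sqr_count_sub => n.
    exact: measurable_near_int.
  - by move=> k y; exact: sqr_ge0.
  - by move=> k; exact: ltW.
  - exact: intV.
  - move=> n; apply: (le_trans (ler_sum _ (fun k _ => wV k))).
    by rewrite -mulr_sumr -[leRHS]mulr1 ler_pM2l ?mulr_gt0// sum_inv_prodS_le.
apply: (@filterS _ _ (ae_filter_ringOfSetsType (@lebesgue_measure R))).
move=> y Hy y01; have [B HB] := Hy y01.
exists (Num.truncn (4 * B)).+1 => k Bk.
have B4 : 4 * B <= k.+1%:R.
  apply/ltW/(lt_le_trans (truncnS_gt (4 * B))).
  by rewrite ler_nat; exact: leqW.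
have MS := half_le_of_sqr_le (M0 k) B4 (HB k).
have SC : S k y <= (count_upto (approx_primes a b alpha y) (N k))%:R.
  apply: count_upto_ge => n n0 n_pr Fn; split=> //.
  by apply: near_int_dist_lt Fn; exact: lt_le_trans ltr01 (x1 n).
have := M_ge k; rewrite ler_pdivrMr ?mulr_gt0// => H.
apply: (le_trans H).
have := le_trans MS SC; rewrite ler_pdivrMr// => H2.
have k1 : 0 < 2 * k.+1%:R :> R by rewrite mulr_gt0.
have := ler_wpM2r (ltW k1) H2.
rewrite /N; lra.
Qed.

(** * From powers of two to the mass dimension *)

Lemma count_upto_mono (A : set nat) (m n : nat) :
  (m <= n)%N -> (count_upto A m <= count_upto A n)%N.
Proof.
move=> mn; rewrite /count_upto [X in (_ <= X)%N](@big_cat_nat _ _ _ m.+1)//=.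
exact: leq_addr.
Qed.

(** From ln (eta x) < eta x, which bounds ln x by a linear function of
    arbitrarily small slope eta. *)
Lemma eventually_ln_le (R : realType) (D eps : R) : 0 < eps ->
  exists k0 : nat, forall k : nat, (k0 <= k)%N ->
    ln D + 2 * ln k.+3%:R <= eps * k%:R.
Proof.
move=> eps0; pose eta := eps / 4.
have eta0 : 0 < eta by rewrite divr_gt0.
pose K := ln D - 2 * ln eta + 6 * eta.
exists (Num.truncn (2 * K / eps)).+1 => k kge.
have kK : 2 * K / eps <= k%:R.
  by apply/ltW/(lt_le_trans (truncnS_gt _)); rewrite ler_nat.
have k3 : 0 < k.+3%:R :> R by [].
have := ln_sublinear (mulr_gt0 eta0 k3).
rewrite lnM ?posrE// -(natr1 k.+2) -(natr1 k.+1) -(natr1 k).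
rewrite ler_pdivrMr// in kK.
by rewrite /K /eta in kK *; lra.
Qed.

(** For 2^k <= N < 2^(k+1), monotonicity of the count transfers both bounds to N,
    so ln (count) differs from s ln N by O(ln k), while ln N is of order k. *)
Lemma log_density_cvg (R : realType) (A : set nat) (s C : R) (k0 : nat) :
  0 <= s <= 1 ->
  (forall k : nat, (count_upto A (2 ^ k))%:R
     <= C * (k.+1%:R * k.+2%:R * (2 ^ k)%:R `^ s)) ->
  (forall k : nat, (k0 <= k)%N -> (2 ^ k.+1)%:R `^ s
     <= 4 * k.+1%:R * (count_upto A (2 ^ k.+1))%:R) ->
  @log_density R A @ \oo --> s.
Proof.
move=> /andP[s0 s1] Hup Hlow.
have l2 : 0 < ln 2 :> R by rewrite ln_gt0// ltr1n.
have C0 : 0 <= C.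
  rewrite leNgt; apply/negP => C0; have := Hup 0%N.
  rewrite expn0 powR1 => H; have := ler0n R (count_upto A 1); lra.
have twos : 2 `^ s <= 2 :> R by rewrite ler1_powR// ler1n.
pose D := 2 * C + 8.
have D0 : 0 < D by rewrite /D; lra.
(* D collects the constants of both bounds: 2 C covers the upper one and 8 the
   lower one, each with a factor 2 for passing from N to a power of two. *)
have key N k : (k0 < k)%N -> (2 ^ k <= N < 2 ^ k.+1)%N ->
    `|s * ln N%:R - ln (count_upto A N)%:R| <= ln D + 2 * ln k.+3%:R :> R.
  move=> k0k /andP[kN Nk].
  have k2 : (0 < 2 ^ k)%N by rewrite expn_gt0.
  have N0 : 0 < N%:R :> R by rewrite ltr0n; exact: leq_trans kN.
  have pk0 : 0 < (2 ^ k)%:R :> R by rewrite ltr0n.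
  have Ns0 : 0 < N%:R `^ s :> R by exact: powR_gt0.
  have kNs : (2 ^ k)%:R `^ s <= N%:R `^ s :> R.
    by apply: ge0_ler_powR; rewrite ?nnegrE ?ler0n ?ler_nat.
  have Nks : N%:R `^ s <= 2 * (2 ^ k)%:R `^ s :> R.
    apply: (@le_trans _ _ ((2 * (2 ^ k)%:R) `^ s)).
      apply: ge0_ler_powR; rewrite ?nnegrE ?ler0n ?mulr_ge0//.
      by rewrite -natrM -expnS ler_nat ltnW.
    by rewrite powRM// ler_wpM2r// powR_ge0.
  have L0 : 0 < k.+3%:R :> R by [].
  have up : (count_upto A N)%:R <= D * k.+3%:R ^+ 2 * N%:R `^ s :> R.
    apply: (@le_trans _ _ (count_upto A (2 ^ k.+1))%:R).
      by rewrite ler_nat count_upto_mono// ltnW.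
    apply: (le_trans (Hup k.+1)).
    rewrite (_ : (2 ^ k.+1)%:R = 2 * (2 ^ k)%:R); last by rewrite expnS natrM.
    rewrite powRM// mulrA.
    have h : 2 `^ s * (2 ^ k)%:R `^ s <= 2 * N%:R `^ s :> R.
      by apply: ler_pM => //; exact: powR_ge0.
    have kk : k.+2%:R * k.+3%:R <= k.+3%:R ^+ 2 :> R.
      by rewrite expr2 ler_pM2r// ler_nat.
    apply: (@le_trans _ _ (C * k.+3%:R ^+ 2 * (2 * N%:R `^ s))).
      apply: ler_pM; last exact: h.
      - by rewrite mulr_ge0.
      - by rewrite mulr_ge0 ?powR_ge0.
      - by rewrite ler_wpM2l.
    have q0 : 0 <= k.+3%:R ^+ 2 * N%:R `^ s.
      by rewrite mulr_ge0// ?exprn_ge0// ltW.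
    rewrite /D; nra.
  have low : N%:R `^ s <= D * k.+3%:R ^+ 2 * (count_upto A N)%:R.
    case: k k0k kN Nk kNs Nks L0 up k2 pk0 => // k k0k kN _ _ Nks L0 _ _ _.
    apply: (le_trans Nks).
    have cA : (count_upto A (2 ^ k.+1))%:R <= (count_upto A N)%:R :> R.
      by rewrite ler_nat count_upto_mono.
    apply: (@le_trans _ _ (8 * k.+1%:R * (count_upto A (2 ^ k.+1))%:R)).
      have := Hlow k k0k; lra.
    apply: ler_pM => //.
    apply: ler_pM => //; first by rewrite /D; lra.
    rewrite expr2; apply: (@le_trans _ _ (1 * k.+4%:R)).
      by rewrite mul1r ler_nat; lia.
    by rewrite ler_pM2r// ler1n.
  have L20 : 0 < k.+3%:R ^+ 2 :> R by exact: exprn_gt0.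
  have DL0 : 0 < D * k.+3%:R ^+ 2 by rewrite mulr_gt0.
  have cA0 : 0 < (count_upto A N)%:R :> R.
    by have := lt_le_trans Ns0 low; rewrite pmulr_rgt0.
  have EL : ln (D * k.+3%:R ^+ 2) = ln D + 2 * ln k.+3%:R.
    by rewrite lnM ?posrE// lnXn// mulr_natl.
  have DLN : 0 < D * k.+3%:R ^+ 2 * N%:R `^ s by exact: mulr_gt0.
  have DLA : 0 < D * k.+3%:R ^+ 2 * (count_upto A N)%:R by exact: mulr_gt0.
  have : ln (count_upto A N)%:R <= ln (D * k.+3%:R ^+ 2 * N%:R `^ s).
    by rewrite ler_ln ?posrE.
  rewrite lnM ?posrE// EL ln_powR => lup.
  have : ln (N%:R `^ s) <= ln (D * k.+3%:R ^+ 2 * (count_upto A N)%:R).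
    by rewrite ler_ln ?posrE.
  rewrite lnM ?posrE// EL ln_powR => llow.
  by rewrite ler_norml; apply/andP; split; lra.
apply/cvgrPdist_le => eps eps0.
have [k1 Hk1] := eventually_ln_le D (mulr_gt0 eps0 l2).
exists (2 ^ (maxn k0 k1).+1)%N => // N /= HN.
have N1 : (0 < N)%N by apply: leq_trans HN; rewrite expn_gt0.
pose k := trunc_log 2 N.
have kN := trunc_log_bounds (isT : (1 < 2)%N) N1; rewrite -/k in kN.
have kge : ((maxn k0 k1).+1 <= k)%N by rewrite trunc_log_max.
have k0k : (k0 < k)%N by apply: leq_trans kge; rewrite ltnS leq_maxl.
have k1k : (k1 <= k)%N.
  by apply: ltnW; apply: leq_trans kge; rewrite ltnS leq_maxr.
have lnN : k%:R * ln 2 <= ln N%:R :> R.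
  rewrite mulr_natl -lnXn// -natrX ler_ln ?posrE ?ltr0n ?expn_gt0//.
  by rewrite ler_nat; case/andP: kN.
have lnN0 : 0 < ln N%:R :> R.
  apply: lt_le_trans lnN; rewrite mulr_gt0// ltr0n.
  exact: leq_ltn_trans k0k.
rewrite /log_density.
have -> : s - ln (count_upto A N)%:R / ln N%:R
    = (s * ln N%:R - ln (count_upto A N)%:R) / ln N%:R.
  by field; rewrite gt_eqF.
rewrite normrM normfV (gtr0_norm lnN0) ler_pdivrMr//.
apply: (le_trans (key N k k0k kN)); apply: (le_trans (Hk1 k k1k)).
nra.
Qed.

Lemma count_upto_set0 (N : nat) : count_upto set0 N = 0%N.
Proof. by rewrite /count_upto big1// => n; rewrite inE. Qed.

Unset Implicit Arguments.

Theorem corollary1p6 (R : realType) (a b alpha : R)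
    (a_gt0 : 0 < a) (a_lt1 : a < 1) (ab : a < b) (alpha_gt1 : 1 < alpha) :
  {ae @lebesgue_measure R, forall y : R, `[0, 1]%classic y ->
    mass_dim_exists R (approx_primes a b alpha y) /\
    mass_dim R (approx_primes a b alpha y) = 1 - a}.
Proof.
have a01 : 0 < a < 1 by rewrite a_gt0.
apply: (@filterS2 _ _ (ae_filter_ringOfSetsType (@lebesgue_measure R))
  _ _ _ _ (ae_count_upto_le b a01 alpha_gt1) (ae_count_upto_ge a01 ab alpha_gt1)).
move=> y Hup Hlow y01; have [C HC] := Hup y01; have [k0 Hk0] := Hlow y01.
have s01 : 0 <= 1 - a <= 1 by lra.
have lim_s := log_density_cvg s01 HC Hk0.
split; last exact: cvg_lim lim_s.
split; last by apply/cvg_ex; exists (1 - a).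
apply/set0P/eqP => A0; have := Hk0 k0 (leqnn _).
rewrite A0 count_upto_set0 mulr0 leNgt powR_gt0//.
Qed.
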